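(* Let $m<n$ and $s\in\{1,\dots,n\}$, let $A\in\mathbb{R}^{m\times n}$ be a fixed matrix with $\ell_2$-normalized columns and coherence $\mu=\mu(A)$, and let $\sigma>0$. For $x\in\mathbb{R}^n$ consider the observation $b=Ax+z$ with $z\sim\mathcal{N}(0,\sigma^2I_m)$. Then any estimator $\hat{x}=\hat{x}(b)$ of $x$ obeys $$\sup_{x:\|x\|_0\le s}\mathbb{E}\|\hat{x}-x\|_2^2\ \ge\ \frac{s\sigma^2}{1+(s-1)\mu}.$$
   Context: For a matrix $A\in\mathbb{R}^{m\times n}$ with columns $A_1,\dots,A_n$ satisfying $\|A_i\|_2=1$ for all $i$, the coherence is $\mu(A)=\max_{1\le i\ne j\le n}|\langle A_i,A_j\rangle|$. The paper's informal phrase ''$A$ satisfies the mutual incoherence property'' means that $\mu(A)$ is small; no quantitative bound on $\mu$ is imposed in this statement. $\|x\|_0$ is the number of nonzero coordinates of $x$. An estimator is a measurable function $\hat{x}:\mathbb{R}^m\to\mathbb{R}^n$ of the observation $b$ (it may depend on $A$, $s$, $\sigma$); the expectation is over $z$. *)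

(* Defs.v *)
From HB Require Import structures.
From mathcomp Require Import all_boot all_order all_algebra.
From mathcomp Require Import all_classical all_reals all_analysis.

Set Implicit Arguments.
Unset Strict Implicit.
Unset Printing Implicit Defensive.

Import Order.TTheory GRing.Theory Num.Theory.
Import numFieldNormedType.Exports.

Local Open Scope classical_set_scope.
Local Open Scope ring_scope.

Definition dotprod (R : realType) (n : nat) (u v : 'cV[R]_n) : R :=
  \sum_(i < n) u i 0 * v i 0.

(* The library norm `|v| on matrices is the sup norm, hence this definition. *)
Definition l2norm (R : realType) (n : nat) (v : 'cV[R]_n) : R :=
  Num.sqrt (dotprod v v).

Definition l0norm (R : realType) (n : nat) (v : 'cV[R]_n) : nat :=
  #|[set i : 'I_n | v i 0 != 0]|%SET.

(* The default value 0 of the maximum is harmless for 1 < n, since every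
   term is nonnegative. *)
Definition coherence (R : realType) (m n : nat) (A : 'M[R]_(m, n)) : R :=
  \big[Num.max/0]_(p : 'I_n * 'I_n | p.1 != p.2)
    `|dotprod (col p.1 A) (col p.2 A)|.

(* R^k as a measurable space is [k.-tuple R], which carries the product of the
   Borel sigma-algebras; linear algebra takes place in column vectors. *)
Definition cV_of_tuple (R : realType) (k : nat) (t : k.-tuple R) : 'cV[R]_k :=
  \col_(i < k) tnth t i.

Definition tuple_of_cV (R : realType) (k : nat) (v : 'cV[R]_k) : k.-tuple R :=
  [tuple v i 0 | i < k].

Definition mutually_independent (d : measure_display) (T : measurableType d)
    (R : realType) (P : probability T R) (k : nat)
    (X : 'I_k -> {RV P >-> R}) : Prop :=
  forall (J : {set 'I_k}) (B : 'I_k -> set R),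
    (forall i, measurable (B i)) ->
    P (\bigcap_(i in [set` J]) (X i @^-1` B i)) =
    (\prod_(i in J) P (X i @^-1` B i))%E.

(* z ~ N(0, sigma^2 I_k): the coordinates are i.i.d. N(0, sigma^2). The second
   parameter of [normal_prob] is the standard deviation. The distributions are
   compared on measurable sets only, their values elsewhere being junk. *)
Definition isotropic_gaussian (d : measure_display) (T : measurableType d)
    (R : realType) (P : probability T R) (k : nat) (sigma : R)
    (z : 'I_k -> {RV P >-> R}) : Prop :=
  mutually_independent z /\
  forall (i : 'I_k) (B : set R), measurable B ->
    distribution P (z i) B = normal_prob 0 sigma B.

Definition observation (R : realType) (m n : nat) (A : 'M[R]_(m, n))
    (x : 'cV[R]_n) (w : 'cV[R]_m) : 'cV[R]_m :=
  A *m x + w.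

(* Main.v *)
(* Write [e_i] for the basis vectors and [b_i x := E xhat_i - x_i] for the bias at
   [x]. Moving [x] by [h e_i] translates the observation by [h A_i], a vector of
   length [h], so that the chi-square divergence between the two laws is
   [exp (h^2 / sigma^2) - 1], and the Chapman--Robbins inequality bounds
   [h + b_i (x + h e_i) - b_i x] in terms of [E (xhat_i - x_i)^2]. Sum over [i < s]
   and average over a large grid of vectors supported on the first [s]
   coordinates: if the risk is at most [rho], the bias is bounded, hence its
   averaged discrete divergence vanishes in the limit. Letting then [h] tend to
   0 yields [s * sigma^2 <= rho], which is stronger than the claim because the
   coherence is nonnegative. *)
Require Import Defs.
From HB Require Import structures.
From mathcomp Require Import all_boot all_order all_algebra.
From mathcomp Require Import all_classical all_reals all_analysis.
From mathcomp Require Import measurable_realfun ring lra.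

Set Implicit Arguments.
Unset Strict Implicit.
Unset Printing Implicit Defensive.

Import Order.TTheory GRing.Theory Num.Theory.
Import numFieldNormedType.Exports.

Local Open Scope classical_set_scope.
Local Open Scope ring_scope.

(** * Sums over boxes and their discrete divergence *)

Section box_sum.
Context {R : realType} {V : zmodType} {I : eqType}.
Variables (e : I -> V) (K : nat).
Implicit Types (r : seq I) (F G : V -> R) (D : set V).

(** Nesting one sum per direction, rather than indexing by points of the box, makes every fact below
    an induction on [r]. *)
Fixpoint box_sum r F (x : V) : R :=
  if r is i :: r' then \sum_(k < K) box_sum r' F (x + e i *+ k) else F x.

Lemma box_sum_le r D F c x :
  (forall i y, i \in r -> D y -> D (y + e i)) -> D x ->
  (forall y, D y -> F y <= c) -> box_sum r F x <= c * (K ^ size r)%:R.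
Proof.
move=> + + Fc; elim: r x => [|i r IH] x De Dx /=; first by rewrite mulr1 Fc.
rewrite expnS natrM mulrCA mulr_natl.
suff H k : box_sum r F (x + e i *+ k) <= c * (K ^ size r)%:R.
  by apply: le_trans (ler_sum _ (fun k _ => H _)) _; rewrite sumr_const card_ord.
apply: IH => [j y jr|]; first by apply: De; rewrite in_cons jr orbT.
elim: k => [|k IHk]; first by rewrite addr0.
by rewrite mulrSr addrA; apply: De => //; rewrite mem_head.
Qed.

Lemma box_sumB r F G x :
  box_sum r (fun y => F y - G y) x = box_sum r F x - box_sum r G x.
Proof.
elim: r x => [//|i r IH] x /=; rewrite -sumrB.
by apply: eq_bigr => k _; rewrite IH.
Qed.

Lemma box_sum_sum r (s : seq I) (F : I -> V -> R) x :
  box_sum r (fun y => \sum_(i <- s) F i y) x = \sum_(i <- s) box_sum r (F i) x.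
Proof.
elim: r x => [//|i r IH] x /=; rewrite exchange_big /=.
by apply: eq_bigr => k _; rewrite IH.
Qed.

Lemma box_sum_translate r F v x :
  box_sum r (fun y => F (y + v)) x = box_sum r F (x + v).
Proof.
elim: r x => [//|i r IH] x /=; apply: eq_bigr => k _.
by rewrite IH addrAC.
Qed.

(** Along direction [i] the sum telescopes to the difference of two opposite faces, each with
    [K ^ (size r).-1] points where [G] is at most [C] in absolute value. *)
Lemma box_sum_difference_ge r D G C x i :
  (forall i y, i \in r -> D y -> D (y + e i)) -> D x ->
  (forall y, D y -> `|G y| <= C) -> i \in r ->
  - (2 * C * (K ^ (size r).-1)%:R) <=
    box_sum r (fun y => G (y + e i) - G y) x.
Proof.
move=> + + GC; elim: r x => [//|j r IH] x De Dx /=.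
have Der l y : l \in r -> D y -> D (y + e l).
  by move=> lr; apply: De; rewrite in_cons lr orbT.
have Dk k : D (x + e j *+ k).
  elim: k => [|k IHk]; first by rewrite addr0.
  by rewrite mulrSr addrA; apply: De => //; rewrite mem_head.
rewrite in_cons; have [ir _|ir] := boolP (i \in r).
  have H (k : 'I_K) := IH _ Der (Dk k) ir.
  apply: le_trans (ler_sum _ (fun k _ => H k)).
  rewrite sumr_const card_ord -(prednK (n := size r)); last by case: (r) ir.
  rewrite expnS natrM mulNrn -mulr_natl lerN2 le_eqVlt.
  by apply/orP; left; apply/eqP; ring.
rewrite orbF => /eqP ->.
have -> : \sum_(k < K) box_sum r (fun y => G (y + e j) - G y) (x + e j *+ k)
    = box_sum r G (x + e j *+ K) - box_sum r G x.
  transitivity (\sum_(0 <= k < K)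
      (box_sum r G (x + e j *+ k.+1) - box_sum r G (x + e j *+ k))); last first.
    by rewrite (telescope_sumr (fun k => box_sum r G (x + e j *+ k))) // addr0.
  rewrite big_mkord; apply: eq_bigr => k _.
  by rewrite box_sumB box_sum_translate -addrA -mulrSr.
have GleC y : D y -> G y <= C by move=> /GC; rewrite ler_norml => /andP[].
(* The far face needs a lower bound on [G]; writing it as an upper bound on [0 - G] lets [box_sumB]
   split the sum. *)
have NGleC y : D y -> 0 - G y <= C.
  by move=> /GC; rewrite ler_norml sub0r lerNl => /andP[].
have H1 := box_sum_le Der Dx GleC.
have := box_sum_le Der (Dk K) NGleC.
rewrite box_sumB.
have -> : box_sum r (fun=> 0) (x + e j *+ K) = 0.
  by elim: (r) (x + _) => [//|l r' IHr] y /=; rewrite big1.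
lra.
Qed.

End box_sum.

(* Averaged over a box of side [K], the discrete divergence of [G] telescopes to
   a flux through the faces, which is O(1/K) as [G] is bounded. *)
Lemma discrete_divergence_ge0 {R : realType} {V : zmodType} {I : eqType}
    (e : I -> V) (r : seq I) (D : set V) (G : I -> V -> R) (C c : R) (x : V) :
  (forall i y, i \in r -> D y -> D (y + e i)) -> D x ->
  (forall i y, i \in r -> D y -> `|G i y| <= C) ->
  (forall y, D y -> \sum_(i <- r) (G i (y + e i) - G i y) <= c) ->
  0 <= c.
Proof.
move=> De Dx GC Gc; have [r0|r0] := posnP (size r).
  by have := Gc x Dx; rewrite (size0nil r0) big_nil.
(* The box has [K ^ size r] points and its faces [K ^ (size r).-1]; division by the latter leaves a
   lower bound on [c * K] that is uniform in [K]. *)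
have bnd K : (0 < K)%N -> - (2 * C * (size r)%:R) <= c * K%:R.
  move=> K0; have := @box_sum_le _ _ _ _ K _ _ _ _ _ De Dx Gc.
  rewrite box_sum_sum => H.
  have K1 : 0 < (K ^ (size r).-1)%:R :> R by rewrite ltr0n expn_gt0 K0.
  rewrite -(ler_pM2r K1) -(mulrA c) -natrM -expnS prednK //.
  apply: le_trans H; rewrite big_seq.
  apply: (@le_trans _ _
     (\sum_(i <- r | i \in r) - (2 * C * (K ^ (size r).-1)%:R))); last first.
    apply: ler_sum => i ir.
    by apply: (@box_sum_difference_ge _ _ _ e K r D (G i) C x i De Dx) => // y;
      exact: GC.
  rewrite -big_seq big_const_seq count_predT iter_addr_0 mulNrn mulNr lerN2.
  by rewrite -[leLHS]mulr_natr mulrAC lexx.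
rewrite leNgt; apply/negP => c0.
(* For [c < 0], a side length beyond [2 * C * size r / - c] violates [bnd]. *)
have := bnd (Num.truncn ((2 * C * (size r)%:R) / - c)).+1 isT.
rewrite leNgt => /negP; apply.
rewrite -ltrN2 opprK -mulNr [ltRHS]mulrC -ltr_pdivrMr ?oppr_gt0 //.
exact: truncnS_gt.
Qed.

(** * Measures given by a density, and transfer of integrals *)

Section density.
Local Open Scope ereal_scope.
Context d (T : measurableType d) (R : realType).
Variables (mu : {measure set T -> \bar R}) (w : T -> R).
Hypotheses (mw : measurable_fun setT w) (w0 : forall x, (0 <= w x)%R).

(* The hypotheses on [w] are parameters so that the canonical measure structure
   below can be inferred. *)
Definition mdensity of measurable_fun setT w & (forall x, (0 <= w x)%R) :=
  fun A : set T => \int[mu]_(x in A) (w x)%:E.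

Let nu := mdensity mw w0.

Let mdensity0 : nu set0 = 0.
Proof. exact: integral_set0. Qed.

Let mdensity_ge0 A : 0 <= nu A.
Proof. by apply: integral_ge0 => x _; rewrite lee_fin. Qed.

Let mdensity_sigma_additive : semi_sigma_additive nu.
Proof.
move=> F mF tF mUF; rewrite /nu /mdensity ge0_integral_bigcup//=.
- by apply: is_cvg_nneseries => n _ _; exact: mdensity_ge0.
- exact/measurable_EFinP/measurable_funTS.
- by move=> x _; rewrite lee_fin.
Qed.

HB.instance Definition _ := isMeasure.Build _ _ _ nu
  mdensity0 mdensity_ge0 mdensity_sigma_additive.

Import HBNNSimple.

(** On simple functions this is linearity and the definition of [nu] on level sets; monotone
    convergence on both sides does the rest. *)
Lemma ge0_integral_density (f : T -> \bar R) :
  measurable_fun setT f -> (forall x, 0 <= f x) ->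
  \int[nu]_x f x = \int[mu]_x (f x * (w x)%:E).
Proof.
move=> mf f0; pose h := nnsfun_approx measurableT mf.
have hf x : (EFin \o h n) x @[n --> \oo] --> f x by exact: cvg_nnsfun_approx.
have hnd x : {homo (fun n => (EFin \o h n) x) : a b / (a <= b)%N >-> a <= b}.
  by move=> a b ab; rewrite lee_fin; exact/lefP/nd_nnsfun_approx.
have mh n : measurable_fun setT (EFin \o h n).
  exact/measurable_EFinP/measurable_funP.
have mwE : measurable_fun setT (EFin \o w) by exact/measurable_EFinP.
transitivity (limn (fun n => \int[nu]_x (EFin \o h n) x)).
  rewrite -monotone_convergence//=.
  - by apply: eq_integral => x _; apply/esym/cvg_lim => //; exact: hf.
  - by move=> n x _; rewrite lee_fin.
  - by move=> x _; exact: hnd.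
transitivity (limn (fun n => \int[mu]_x ((EFin \o h n) x * (w x)%:E))); last first.
  rewrite -monotone_convergence//=.
  - apply: eq_integral => x _; apply/cvg_lim => //.
    by apply: cvgeZr => //; exact: hf.
  - by move=> n; apply: emeasurable_funM; [exact: mh|exact: mwE].
  - by move=> n x _; rewrite mule_ge0 ?lee_fin.
  - by move=> x _ a b ab; rewrite lee_wpmul2r ?lee_fin//; exact: hnd.
congr (limn _); apply/funext => n.
have mi r : measurable_fun setT (fun x => (r * \1_(h n @^-1` [set r]) x)%:E).
  by apply/measurable_EFinP; exact: measurable_funM.
transitivity (\int[nu]_x
   (\sum_(y \in range (h n)) (y * \1_(h n @^-1` [set y]) x)%:E)).
  by apply: eq_integral => x _; rewrite /= fimfunE -fsumEFin.
rewrite ge0_integral_fsum//; last by move=> y x _; exact: nnfun_muleindic_ge0.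
transitivity (\int[mu]_x (\sum_(y \in range (h n))
    (y * \1_(h n @^-1` [set y]) x)%:E * (w x)%:E)); last first.
  apply: eq_integral => x _.
  rewrite -ge0_mule_fsuml => [|y]; last exact: nnfun_muleindic_ge0.
  by rewrite fsumEFin // -fimfunE.
rewrite ge0_integral_fsum//; last 2 first.
  - by move=> y; exact: emeasurable_funM.
  - by move=> y x _; rewrite mule_ge0 ?lee_fin// -lee_fin nnfun_muleindic_ge0.
apply: eq_fsbigr => r rh.
have r0 : (0 <= r)%R by move: rh; rewrite inE => -[t _ <-].
under eq_integral do rewrite EFinM.
rewrite ge0_integralZl//; last first.
  exact/measurable_EFinP.
rewrite integral_indic//= setIT.
under [RHS]eq_integral do rewrite EFinM -muleA.
rewrite ge0_integralZl//; last 2 first.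
- by apply: emeasurable_funM => //; exact/measurable_EFinP.
- by move=> x _; rewrite mule_ge0 ?lee_fin.
congr (_ * _); rewrite /nu /mdensity integral_mkcond.
by apply: eq_integral => x _; rewrite epatch_indic muleC.
Qed.

End density.

(** The hypothesis on [B] says that [nu] is the image under [X] of the measure with density [w]. All
    changes of measure below are instances, including those with [X] the identity or [w]
    constant. *)
Lemma ge0_integral_weighted_transfer {d d'} {T : measurableType d}
    {T' : measurableType d'} {R : realType} (mu : {measure set T -> \bar R})
    (nu : {measure set T' -> \bar R}) (X : T -> T') (w : T -> R)
    (f : T' -> \bar R) :
  measurable_fun setT X -> measurable_fun setT w -> (forall x, 0 <= w x) ->
  (forall B, measurable B ->
    (\int[mu]_(x in X @^-1` B) (w x)%:E = nu B)%E) ->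
  measurable_fun setT f -> (forall y, (0 <= f y)%E) ->
  (\int[mu]_x (f (X x) * (w x)%:E) = \int[nu]_y f y)%E.
Proof.
move=> mX mw w0 munu mf f0.
have mfX : measurable_fun setT (f \o X) by exact: measurableT_comp.
rewrite -(ge0_integral_density mu mw w0 mfX); last by move=> x; exact: f0.
transitivity (\int[pushforward (mdensity mu mw w0) X]_y f y)%E.
  by rewrite ge0_integral_pushforward.
by apply: eq_measure_integral => B mB _; rewrite -munu.
Qed.

(** * Expectation of a product of functions of independent variables *)

Lemma independent_integral_prod {d} {T : measurableType d} {R : realType}
    (P : probability T R) (k : nat) (X : 'I_k -> {RV P >-> R})
    (f : 'I_k -> R -> R) :
  mutually_independent X ->
  (forall i, measurable_fun setT (f i)) -> (forall i y, 0 <= f i y) ->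
  (forall i, (\int[P]_w (f i (X i w))%:E < +oo)%E) ->
  (\int[P]_w (\prod_(i < k) f i (X i w))%:E =
   \prod_(i < k) \int[P]_w (f i (X i w))%:E)%E.
Proof.
move=> indX.
(* Indicators are replaced by general functions one coordinate at a time, [l]
   listing the coordinates already treated. *)
suff H (l : seq 'I_k) (g : 'I_k -> R -> R) :
    (forall i, i \notin l -> exists2 B, measurable B & g i = \1_B) ->
    (forall i, measurable_fun setT (g i)) -> (forall i y, 0 <= g i y) ->
    (forall i, (\int[P]_w (g i (X i w))%:E < +oo)%E) ->
    (\int[P]_w (\prod_(i < k) g i (X i w))%:E =
     \prod_(i < k) \int[P]_w (g i (X i w))%:E)%E.
  by apply: (H (enum 'I_k)) => i; rewrite mem_enum.
elim: l g => [|i l IH] g gl mg g0 gfin.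
  (* When all factors are indicators, their product is the indicator of an intersection, and the
     claim is the definition of independence. *)
  have /choice[B HB] i : exists B, measurable B /\ g i = \1_B.
    by have [//|B mB ->] := gl i; exists B.
  have mXB i : measurable (X i @^-1` B i).
    by rewrite -[X in measurable X]setTI; apply: measurable_funP => //; exact: (HB i).1.
  transitivity (P (\bigcap_(i in [set` [set: 'I_k]%SET]) (X i @^-1` B i))); last first.
    rewrite (indX _ _ (fun i => (HB i).1)); apply: eq_big => [i|i _].
      by rewrite inE.
    rewrite -[X in P X](setIT (X i @^-1` B i)) -integral_indic//.
    by apply: eq_integral => w _; rewrite (HB i).2.
  rewrite (_ : (fun w => _) = EFin \o
      \1_(\bigcap_(i in [set` [set: 'I_k]%SET]) (X i @^-1` B i))).
    rewrite integral_indic ?setIT//.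
    by apply: fin_bigcap_measurable => // i _; exact: mXB.
  apply/funext => w /=; congr (_%:E).
  rewrite indicE; have [/set_mem wB|/negP wB] := boolP (w \in _).
    rewrite big1// => j _; rewrite (HB j).2 indicE mem_set//.
    by apply: (wB j) => /=; rewrite inE.
  have [j wj] : exists j, ~ B j (X j w).
    by apply/existsNP => wB'; apply: wB; apply/mem_set => j _; exact: wB'.
  by rewrite (bigD1 j)//= (HB j).2 indicE memNset// mul0r.
have mgX j : measurable_fun setT (fun w => g j (X j w)).
  by apply: (measurableT_comp (mg j)).
(* The other factors serve as a density. The induction hypothesis, with an indicator [\1_B] in place
   of [g i], says that the image of this density under [X i] is [c] times the law of [X i]; the
   transfer lemma then restores [g i]. *)
pose w (x : T) := \prod_(j < k | j != i) g j (X j x).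
have mw : measurable_fun setT w.
  rewrite /w; under eq_fun do rewrite -big_filter.
  by apply: measurable_prod => j _; exact: mgX.
have w0 x : 0 <= w x by apply: prodr_ge0 => j _; exact: g0.
have cfin : (\prod_(j < k | j != i) \int[P]_w (g j (X j w))%:E)%E \is a fin_num.
  apply: prode_fin_num => j _; rewrite ge0_fin_numE//.
  by apply: integral_ge0 => x _; rewrite lee_fin.
have c0 : (0 <= \prod_(j < k | j != i) \int[P]_w (g j (X j w))%:E)%E.
  by apply: prode_ge0 => j _; apply: integral_ge0 => x _; rewrite lee_fin.
pose c := NngNum (fine_ge0 c0).
have cE : c%:num%:E = (\prod_(j < k | j != i) \int[P]_w (g j (X j w))%:E)%E.
  by rewrite fineK.
under eq_integral do rewrite (bigD1 i)//= EFinM.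
rewrite (bigD1 i)//= -cE muleC.
have mgi : measurable_fun setT (EFin \o g i) by exact/measurable_EFinP.
rewrite -(ge0_integral_distribution (X i) mgi); last by move=> y; rewrite lee_fin.
rewrite -ge0_integral_mscale//; last by move=> y _; rewrite lee_fin.
apply: (@ge0_integral_weighted_transfer _ _ _ _ _ P (mscale c (distribution P (X i)))
  (X i) w (EFin \o g i)) => //; last by move=> y; rewrite lee_fin.
move=> B mB.
have mXB : measurable (X i @^-1` B).
  by rewrite -[X in measurable X]setTI; exact: measurable_funP.
pose g' j := if j == i then \1_B else g j.
have := IH g'; rewrite (bigD1 i)//= /g' eqxx.
have -> : (\int[P]_w (\1_B (X i w))%:E = P (X i @^-1` B))%E.
  by rewrite -[X in P X](setIT (X i @^-1` B)) -integral_indic//.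
under [X in (_ * X)%E]eq_bigr => j ji do rewrite (negbTE ji).
rewrite -cE => IHi; transitivity (P (X i @^-1` B) * c%:num%:E)%E; last first.
  by rewrite muleC.
rewrite -IHi.
- rewrite integral_mkcond; apply: eq_integral => x _.
  rewrite (bigD1 i)//= eqxx epatch_indic -EFinM mulrC; congr (_ * _)%:E.
  by apply: eq_bigr => j ji; rewrite (negbTE ji).
- move=> j jl; have [_|ji] := eqVneq j i; first by exists B.
  by apply: gl; rewrite in_cons (negbTE ji).
- by move=> j; case: ifP => // _; exact: measurable_indic.
- by move=> j y; case: ifP.
- move=> j; case: ifP => // _; apply: (@le_lt_trans _ _ (\int[P]_w (cst 1 w))%E).
    apply: ge0_le_integral => //.
    + by apply/measurable_EFinP; apply: (measurableT_comp (measurable_indic _)).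
    + by move=> x _; rewrite lee_fin indicE lern1 leq_b1.
  rewrite integral_cst//= mul1e.
  exact: le_lt_trans (probability_le1 P measurableT) (ltry _).
Qed.

(** * Translation of Lebesgue measure and of the normal law on the line *)

Lemma lebesgue_measure_translate {R : realType} (t : R) (B : set R) :
  measurable B ->
  lebesgue_measure ((fun y : R => y + t) @^-1` B) = lebesgue_measure B.
Proof.
have mt : measurable_fun setT (fun y : measurableTypeR R => y + t : measurableTypeR R).
  exact: measurable_funD.
pose m := pushforward lebesgue_measure
  (fun y : measurableTypeR R => y + t : measurableTypeR R).
move=> mB; apply/esym/(@lebesgue_measure_unique _ m) => // _ [[a b] /= _ <-].
rewrite /m /pushforward.
rewrite (_ : _ @^-1` _ = `]a - t, b - t]%classic).
  rewrite !lebesgue_measure_itv /= !lte_fin ltrD2r.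
  by case: ifP => // _; rewrite -!EFinB; congr (_%:E); ring.
by apply/seteqP; split=> y /=; rewrite !in_itv /= ltrBlDr lerBrDr.
Qed.

(** The density of N(t, sigma^2) with respect to N(0, sigma^2). *)
Definition gaussian_ratio {R : realType} (sigma t y : R) : R :=
  expR (t * y / sigma ^+ 2 - t ^+ 2 / (2 * sigma ^+ 2)).

Lemma measurable_gaussian_ratio {R : realType} (sigma t : R) :
  measurable_fun setT (gaussian_ratio sigma t).
Proof.
apply: measurableT_comp => //=; apply: measurable_funB => //.
by apply: measurable_funM => //; apply: measurable_funM.
Qed.

Lemma normal_pdf_shift {R : realType} (sigma t y : R) : sigma != 0 ->
  normal_pdf 0 sigma (y - t) =
  normal_pdf 0 sigma y * gaussian_ratio sigma t y.
Proof.
move=> s0; rewrite !normal_pdfE// -mulrA /normal_fun -expRD.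
by congr (_ * expR _); field.
Qed.

(** Translation invariance of Lebesgue measure moves the shift from the set to the density, where
    [normal_pdf_shift] factors it out. *)
Lemma normal_prob_shift {R : realType} (sigma t : R) (B : set R) :
  sigma != 0 -> measurable B ->
  normal_prob 0 sigma ((fun y : R => y + t) @^-1` B) =
  (\int[normal_prob 0 sigma]_(y in B) (gaussian_ratio sigma t y)%:E)%E.
Proof.
move=> s0 mB.
have mt : measurable_fun setT (fun y : measurableTypeR R => y + t : measurableTypeR R).
  exact: measurable_funD.
have mg := measurable_gaussian_ratio sigma t.
transitivity (\int[lebesgue_measure]_(y in B)
    (normal_pdf 0 sigma ((y : R) - t)%R)%:E)%E.
  transitivity (\int[pushforward lebesgue_measure
      (fun y : measurableTypeR R => (y + t)%R : measurableTypeR R)]_(y in B)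
      (normal_pdf 0 sigma ((y : R) - t)%R)%:E)%E.
    rewrite ge0_integral_pushforward//.
    - by apply: eq_integral => y _ /=; rewrite addrK.
    - apply/measurable_funTS/measurable_EFinP.
      apply: (measurableT_comp (measurable_normal_pdf _ _)) => //.
      exact: measurable_funB.
    - by move=> y _; rewrite lee_fin normal_pdf_ge0.
  by apply: eq_measure_integral => C mC _; exact: lebesgue_measure_translate.
rewrite integral_mkcond [RHS]integral_mkcond.
rewrite -(@ge0_integral_weighted_transfer _ _ _ _ _ lebesgue_measure
  (normal_prob 0 sigma) idfun (normal_pdf 0 sigma)) //.
- apply: eq_integral => y _; rewrite !epatch_indic normal_pdf_shift// !EFinM /=.
  by rewrite -muleA muleC.
- exact: measurable_id.
- exact: measurable_normal_pdf.
- by move=> y; exact: normal_pdf_ge0.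
- apply/(measurable_restrictT _ _).1 => //.
  exact/measurable_funTS/measurable_EFinP.
- by move=> y; apply: erestrict_ge0 => z _; rewrite lee_fin expR_ge0.
Qed.

(** * Measures on tuples are determined by rectangles *)

Lemma measure_tuple_unique {d} {T : measurableType d} {R : realType} (k : nat)
    (m1 m2 : {measure set (k.-tuple T) -> \bar R}) :
  (forall B : 'I_k -> set T, (forall i, measurable (B i)) ->
    m1 [set t | forall i, B i (tnth t i)] =
    m2 [set t | forall i, B i (tnth t i)]) ->
  (m1 setT < +oo)%E ->
  forall A, measurable A -> m1 A = m2 A.
Proof.
move=> m12 m1fin.
pose rect (B : 'I_k -> set T) := [set t : k.-tuple T | forall i, B i (tnth t i)].
pose G := [set rect B | B in [set B | forall i, measurable (B i)]].
have rectT : rect (fun=> setT) = setT by apply/seteqP; split.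
apply: (measure_unique G (fun=> setT)).
(* Rectangles generate: a coordinate preimage is a rectangle whose other sides are full, and a
   rectangle is a finite intersection of coordinate preimages. *)
- apply/seteqP; split.
    apply: smallest_sub; first exact: smallest_sigma_algebra.
    rewrite -bigcup_seq => A [i /= _ [Y mY <-]]; rewrite setTI.
    apply: sub_sigma_algebra; exists (fun j => if j == i then Y else setT).
      by move=> j /=; case: ifP.
    apply/seteqP; split => [t /(_ i)|t Yt j]; first by rewrite eqxx.
    by case: eqP => // ->.
  apply: smallest_sub; first exact: sigma_algebra_measurable.
  move=> _ [B mB <-].
  rewrite (_ : rect B = \bigcap_(i in [set: 'I_k]) ((@tnth k T)^~ i @^-1` B i)).
    apply: fin_bigcap_measurable => // i _.
    rewrite -[X in measurable X]setTI; exact: measurable_tnth.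
  by apply/seteqP; split => [t Bt i _|t Bt i]; [exact: Bt|exact: (Bt i I)].
- move=> _ _ [B mB <-] [C mC <-]; exists (fun i => B i `&` C i).
    by move=> i; exact: measurableI.
  apply/seteqP; split => [t BCt|t [Bt Ct] i]; last by split; [exact: Bt|exact: Ct].
  by split => i; have [] := BCt i.
- by move=> _; exists (fun=> setT).
- by rewrite bigcup_const//; exists 0%N.
- by move=> _ [B mB <-]; exact: m12.
- by [].
Qed.

(** * Shifts of a Gaussian vector and the likelihood ratio *)

Section gaussian_shift.
Context {d : measure_display} {T : measurableType d} {R : realType}.
Variables (P : probability T R) (m : nat) (sigma : R).
Variable z : 'I_m -> {RV P >-> R}.
Hypotheses (sigma_gt0 : 0 < sigma) (hz : isotropic_gaussian sigma z).

Let noise (w : T) : 'cV[R]_m := \col_(i < m) z i w.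

Lemma measurable_shifted_noise (t : 'cV[R]_m) :
  measurable_fun setT (fun w => tuple_of_cV (t + noise w)).
Proof.
apply/measurable_fun_tnthP => i.
rewrite (_ : _ \o _ = fun w => t i 0 + z i w); first exact: measurable_funD.
by apply/funext => w /=; rewrite tnth_mktuple !mxE.
Qed.

(** The density of the law of [t + noise] with respect to that of [noise], evaluated at the noise
    itself. *)
Definition likelihood_ratio (t : 'cV[R]_m) (w : T) : R :=
  \prod_(i < m) gaussian_ratio sigma (t i 0) (z i w).

Lemma likelihood_ratio_gt0 t w : 0 < likelihood_ratio t w.
Proof. by apply: prodr_gt0 => i _; exact: expR_gt0. Qed.

Lemma measurable_likelihood_ratio t : measurable_fun setT (likelihood_ratio t).
Proof.
apply: measurable_prod => i _.
exact: (measurableT_comp (measurable_gaussian_ratio _ _)).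
Qed.

(** Doubling the exponent doubles the linear term, as does the shift [t *+ 2], whose quadratic term
    is too large by exactly [dotprod t t / sigma ^+ 2]. The second moment thus reduces to a total
    mass. *)
Lemma sqr_likelihood_ratio t w :
  likelihood_ratio t w ^+ 2 =
  expR (dotprod t t / sigma ^+ 2) * likelihood_ratio (t *+ 2) w.
Proof.
have s0 : sigma != 0 by rewrite gt_eqF.
rewrite /dotprod mulr_suml expR_sum -big_split -prodrXl /=.
apply: eq_bigr => i _; rewrite /gaussian_ratio -expRM_natl -expRD mulmxnE.
by congr expR; field.
Qed.

(* Rectangles determine the law of the vector, and on a rectangle independence
   reduces the claim to one dimension. *)
Lemma ge0_gaussian_shift (t : 'cV[R]_m) (f : m.-tuple R -> \bar R) :
  measurable_fun setT f -> (forall y, (0 <= f y)%E) ->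
  (\int[P]_w f (tuple_of_cV (t + noise w)) =
   \int[P]_w (f (tuple_of_cV (0 + noise w)) * (likelihood_ratio t w)%:E))%E.
Proof.
move=> mf f0; have [indz lawz] := hz.
have s0 : sigma != 0 by rewrite gt_eqF.
have mX u := measurable_shifted_noise u.
have mL := measurable_likelihood_ratio t.
have L0 w : 0 <= likelihood_ratio t w by exact/ltW/likelihood_ratio_gt0.
pose Xt : {mfun T >-> m.-tuple R} :=
  HB.pack (fun w => tuple_of_cV (t + noise w)) (isMeasurableFun.Build _ _ _ _ _ (mX t)).
pose X0 : {mfun T >-> m.-tuple R} :=
  HB.pack (fun w => tuple_of_cV (0 + noise w)) (isMeasurableFun.Build _ _ _ _ _ (mX 0)).
rewrite -(ge0_integral_distribution (P := P) Xt mf f0).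
apply/esym/(@ge0_integral_weighted_transfer _ _ _ _ _ P (distribution P Xt) X0) => //.
move=> A mA; apply/esym.
apply: (@measure_tuple_unique _ _ _ _ (distribution P Xt)
  (pushforward (mdensity P mL L0) X0)) => //; last first.
  exact: le_lt_trans (probability_le1 (distribution P Xt) measurableT) (ltry _).
move=> B mB; rewrite /= /distribution /pushforward /mdensity.
have mzB i (C : set R) : measurable C -> measurable (z i @^-1` C).
  by move=> mC; rewrite -[X in measurable X]setTI; exact: measurable_funP.
pose B' i := (fun y : R => y + t i 0) @^-1` B i.
have mB' i : measurable (B' i).
  rewrite -[X in measurable X]setTI.
  by apply: (measurable_funD (@measurable_id _ _ _) (measurable_cst _)).
pose g i y := \1_(B i) y * gaussian_ratio sigma (t i 0) y.
have mg i : measurable_fun setT (g i).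
  by apply: measurable_funM => //; exact: measurable_gaussian_ratio.
have g0 i y : 0 <= g i y by rewrite mulr_ge0// expR_ge0.
have gE i : (\int[P]_w (g i (z i w))%:E = P (z i @^-1` B' i))%E.
  have mgE : measurable_fun setT (EFin \o g i) by exact/measurable_EFinP.
  rewrite -(ge0_integral_distribution (z i) mgE); last by move=> y; rewrite lee_fin.
  rewrite -[RHS]/(distribution P (z i) (B' i)) lawz// normal_prob_shift//.
  rewrite [RHS]integral_mkcond.
  transitivity (\int[normal_prob 0 sigma]_y (g i y)%:E)%E.
    (* The law of [z i] is known to be normal on measurable sets only, so the integrals are compared
       by a transfer along the identity with weight 1. *)
    rewrite -(@ge0_integral_weighted_transfer _ _ _ _ _ (normal_prob 0 sigma)
      (distribution P (z i)) idfun (cst 1) _ (@measurable_id _ _ _)) //.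
    - by apply: eq_integral => y _; rewrite mule1.
    - move=> C mC; apply: etrans (esym (lawz i C mC)).
      by apply: etrans (mul1e _); rewrite -integral_cst.
    - by move=> y; rewrite lee_fin.
  by apply: eq_integral => y _; rewrite epatch_indic /g EFinM muleC.
have -> : Xt @^-1` [set u : m.-tuple R | forall i, B i (tnth u i)] =
    \bigcap_(i in [set` [set: 'I_m]%SET]) (z i @^-1` B' i).
  apply/seteqP; split => [w Bw i _|w Bw i].
    by have := Bw i; rewrite /= tnth_mktuple !mxE addrC.
  have := Bw i; rewrite /= tnth_mktuple !mxE addrC; apply.
  by rewrite inE.
rewrite indz//.
transitivity (\prod_(i < m) \int[P]_w (g i (z i w))%:E)%E.
  by apply: eq_big => [i|i _]; [rewrite inE|rewrite gE].
rewrite -independent_integral_prod//; last first.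
  by move=> i; rewrite gE; apply: le_lt_trans (ltry 1); exact/probability_le1/mzB.
rewrite [RHS]integral_mkcond; apply: eq_integral => w _.
rewrite epatch_indic -EFinM big_split /= mulrC; congr (_ * _)%:E.
rewrite indicE; have [/set_mem wB|/negP wB] := boolP (w \in _).
  rewrite big1// => j _; rewrite indicE mem_set//.
  by have := wB j; rewrite /= tnth_mktuple !mxE add0r.
have [j wj] : exists j, ~ B j (z j w).
  apply/existsNP => wB'; apply: wB; apply/mem_set => j /=.
  by rewrite tnth_mktuple !mxE add0r.
by rewrite (bigD1 j)//= indicE memNset// mul0r.
Qed.

Lemma integral_likelihood_ratio t :
  (\int[P]_w (likelihood_ratio t w)%:E = 1)%E.
Proof.
have := @ge0_gaussian_shift t (cst 1%E) (measurable_cst _) (fun=> lee01).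
under [in RHS]eq_integral do rewrite mul1e.
by rewrite integral_cst// mul1e => <-; exact: probability_setT.
Qed.

(** This is one plus the chi-square divergence between the shifted and the unshifted law. *)
Lemma integral_sqr_likelihood_ratio t :
  (\int[P]_w (likelihood_ratio t w ^+ 2)%:E =
   (expR (dotprod t t / sigma ^+ 2))%:E)%E.
Proof.
under eq_integral do rewrite sqr_likelihood_ratio EFinM.
rewrite ge0_integralZl//.
- by rewrite integral_likelihood_ratio mule1.
- exact/measurable_EFinP/measurable_likelihood_ratio.
- by move=> w _; rewrite lee_fin ltW// likelihood_ratio_gt0.
Qed.

(** Positive and negative parts are treated separately; multiplication by the nonnegative ratio
    commutes with both. *)
Lemma gaussian_shift (t : 'cV[R]_m) (g : m.-tuple R -> R) :
  measurable_fun setT g ->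
  \int[P]_w g (tuple_of_cV (t + noise w)) =
  \int[P]_w (g (tuple_of_cV (0 + noise w)) * likelihood_ratio t w).
Proof.
move=> mg; rewrite /Rintegral; congr fine.
have L0 w : 0 <= likelihood_ratio t w by exact/ltW/likelihood_ratio_gt0.
rewrite integralE [RHS]integralE.
have mgE : measurable_fun setT (EFin \o g) by exact/measurable_EFinP.
congr (_ - _)%E.
- transitivity (\int[P]_w (EFin \o g)^\+ (tuple_of_cV (t + noise w)))%E.
    by apply: eq_integral => w _; rewrite !funeposE.
  rewrite ge0_gaussian_shift//; last exact: measurable_funepos.
  apply: eq_integral => w _; rewrite !funeposE /= -!EFin_max -EFinM.
  by rewrite maxr_pMl// mul0r.
- transitivity (\int[P]_w (EFin \o g)^\- (tuple_of_cV (t + noise w)))%E.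
    by apply: eq_integral => w _; rewrite !funenegE.
  rewrite ge0_gaussian_shift//; last exact: measurable_funeneg.
  apply: eq_integral => w _; rewrite !funenegE /= -!EFin_max -EFinM.
  by rewrite maxr_pMl// mul0r mulNr.
Qed.

End gaussian_shift.

(** * Square-integrable functions on a probability space *)

Section square_integrable.
Context {d : measure_display} {T : measurableType d} {R : realType}.
Variable P : probability T R.
Implicit Types f g : T -> R.

Lemma Rintegral_probability_cst (c : R) : \int[P]_w c = c.
Proof.
by rewrite Rintegral_cst// [X in fine X](probability_setT P) mulr1.
Qed.

Lemma sqr_integrableM f g :
  measurable_fun setT f -> measurable_fun setT g ->
  P.-integrable setT (fun w => (f w ^+ 2)%:E) ->
  P.-integrable setT (fun w => (g w ^+ 2)%:E) ->
  P.-integrable setT (fun w => (f w * g w)%:E).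
Proof.
move=> mf mg if2 ig2; apply: le_integrable (integrableD measurableT if2 ig2) => //.
  by apply/measurable_EFinP; exact: measurable_funM.
move=> w _ /=; rewrite lee_fin [leRHS]ger0_norm ?addr_ge0 ?sqr_ge0// ler_norml.
apply/andP; split; have := sqr_ge0 (f w + g w); have := sqr_ge0 (f w - g w);
  have := sqr_ge0 (f w); have := sqr_ge0 (g w); nra.
Qed.

Lemma sqr_integrable_integrable f :
  measurable_fun setT f -> P.-integrable setT (fun w => (f w ^+ 2)%:E) ->
  P.-integrable setT (fun w => (f w)%:E).
Proof.
move=> mf if2.
have i1 : P.-integrable setT (fun _ : T => (1 ^+ 2)%:E).
  exact: finite_measure_integrable_cst.
have m1 : measurable_fun setT (cst 1 : T -> R) by exact: measurable_cst.
have := sqr_integrableM mf m1 if2 i1.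
by apply: eq_integrable => // w _; rewrite mulr1.
Qed.

(** From [|f| <= 1 + f ^+ 2] pointwise; this turns a bound on the risk into a uniform bound on the
    bias. *)
Lemma normr_Rintegral_le_sqr f :
  measurable_fun setT f -> P.-integrable setT (fun w => (f w ^+ 2)%:E) ->
  `|\int[P]_w f w| <= 1 + \int[P]_w (f w ^+ 2).
Proof.
move=> mf if2; have if1 := sqr_integrable_integrable mf if2.
have i1 : P.-integrable setT (fun _ : T => 1%:E).
  exact: finite_measure_integrable_cst.
apply: le_trans (le_normr_Rintegral _ if1) _ => //.
have <- : \int[P]_w (1 + f w ^+ 2) = 1 + \int[P]_w (f w ^+ 2).
  rewrite RintegralD//; congr (_ + _).
  exact: Rintegral_probability_cst.
apply: le_Rintegral.
- exact: measurableT.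
- exact: integrable_norm.
- exact: (integrableD measurableT i1 if2).
- move=> w _; have := sqr_ge0 (`|f w| - 1); rewrite -(real_normK (num_real (f w))).
  by have := normr_ge0 (f w); nra.
Qed.

End square_integrable.

(** * The Chapman--Robbins inequality *)

Section gaussian_location.
Context {d : measure_display} {T : measurableType d} {R : realType}.
Variables (P : probability T R) (m : nat) (sigma : R).
Variable z : 'I_m -> {RV P >-> R}.
Hypotheses (sigma_gt0 : 0 < sigma) (hz : isotropic_gaussian sigma z).

Let noise (w : T) : 'cV[R]_m := \col_(i < m) z i w.

(* Hammersley--Chapman--Robbins: the difference of the means is the covariance
   of [g] with the likelihood ratio, here bounded by AM-GM with a free weight
   [lam] rather than by Cauchy--Schwarz. *)
Lemma gaussian_chapman_robbins (u t : 'cV[R]_m) (g : m.-tuple R -> R) (lam : R) :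
  0 < lam -> measurable_fun setT g ->
  P.-integrable setT (fun w => (g (tuple_of_cV (u + noise w)) ^+ 2)%:E) ->
  \int[P]_w g (tuple_of_cV ((u + t) + noise w)) -
    \int[P]_w g (tuple_of_cV (u + noise w)) <=
  lam / 2 * \int[P]_w (g (tuple_of_cV (u + noise w)) ^+ 2) +
    (expR (dotprod t t / sigma ^+ 2) - 1) / (2 * lam).
Proof.
move=> lam0 mg ig2.
pose h w := g (tuple_of_cV (u + noise w)).
have mh : measurable_fun setT h.
  exact: (measurableT_comp mg (measurable_shifted_noise z u)).
pose L := likelihood_ratio sigma z t.
have mL : measurable_fun setT L by exact: measurable_likelihood_ratio.
have iL2 : P.-integrable setT (fun w => (L w ^+ 2)%:E).
  apply/integrableP; split.
    by apply/measurable_EFinP; exact: measurable_funX.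
  under eq_integral do rewrite gee0_abs ?lee_fin ?sqr_ge0//.
  by rewrite integral_sqr_likelihood_ratio// ltry.
have iL := sqr_integrable_integrable mL iL2.
have ih := sqr_integrable_integrable mh ig2.
have ihL := sqr_integrableM mh mL ig2 iL2.
have i1 : P.-integrable setT (fun _ : T => 1%:E).
  exact: finite_measure_integrable_cst.
have -> : \int[P]_w g (tuple_of_cV ((u + t) + noise w)) = \int[P]_w (h w * L w).
  (* The shift formula has base point 0; composing [g] with the translation by [u] moves it to
     [u]. *)
  pose tr (b : m.-tuple R) := tuple_of_cV (u + cV_of_tuple b).
  have mtr : measurable_fun setT tr.
    apply/measurable_fun_tnthP => i.
    rewrite (_ : _ \o _ = fun b => u i 0 + tnth b i).
      by apply: measurable_funD => //; exact: measurable_tnth.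
    by apply/funext => b /=; rewrite tnth_mktuple !mxE.
  have trE v w : tr (tuple_of_cV (v + noise w)) = tuple_of_cV (u + v + noise w).
    by apply: eq_from_tnth => i; rewrite !tnth_mktuple !mxE tnth_mktuple !mxE addrA.
  have := gaussian_shift sigma_gt0 hz t (measurableT_comp mg mtr).
  rewrite /= -/noise.
  under eq_Rintegral do rewrite trE.
  under [in RHS]eq_Rintegral do rewrite trE addr0.
  by [].
rewrite -RintegralB//.
have EL : \int[P]_w L w = 1.
  by rewrite /Rintegral integral_likelihood_ratio.
have EL2 : \int[P]_w (L w ^+ 2) = expR (dotprod t t / sigma ^+ 2).
  by rewrite /Rintegral integral_sqr_likelihood_ratio.
pose a := (2 * lam)^-1.
have iA : P.-integrable setT (fun w => (lam / 2 * h w ^+ 2)%:E).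
  exact: (integrableZl measurableT (lam / 2) ig2).
have iB : P.-integrable setT (fun w => (a * L w ^+ 2)%:E).
  exact: (integrableZl measurableT a iL2).
have iC : P.-integrable setT (fun w => (2 * a * L w)%:E).
  exact: (integrableZl measurableT (2 * a) iL).
have iD : P.-integrable setT (fun _ : T => a%:E).
  exact: finite_measure_integrable_cst.
have iBD : P.-integrable setT (fun w => (a * L w ^+ 2 + a)%:E).
  exact: (integrableD measurableT iB iD).
have iBCD : P.-integrable setT (fun w => (a * L w ^+ 2 + a - 2 * a * L w)%:E).
  exact: (integrableB measurableT iBD iC).
(* The last summand is [a * (L w - 1) ^+ 2] expanded; since [L] has mean 1, its integral is [a]
   times the second moment of [L] minus 1. The integrands then compare by AM-GM. *)
have -> : lam / 2 * \int[P]_w (g (tuple_of_cV (u + noise w)) ^+ 2) +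
    (expR (dotprod t t / sigma ^+ 2) - 1) / (2 * lam) =
    \int[P]_w (lam / 2 * h w ^+ 2 + (a * L w ^+ 2 + a - 2 * a * L w)).
  rewrite RintegralD// RintegralB// RintegralD// !RintegralZl// EL EL2.
  rewrite Rintegral_probability_cst; congr (_ + _).
  by rewrite -/a; ring.
apply: le_Rintegral.
- exact: measurableT.
- exact: (integrableB measurableT ihL ih).
- exact: (integrableD measurableT iA iBCD).
- move=> w _; rewrite -/(h w) -subr_ge0.
  rewrite [X in 0 <= X](_ : _ = (lam * h w - (L w - 1)) ^+ 2 * a).
    by rewrite mulr_ge0 ?sqr_ge0// invr_ge0 mulr_ge0// ltW.
  by rewrite /a; field; rewrite gt_eqF.
Qed.

End gaussian_location.

(** * Auxiliary facts on norms, coherence and real inequalities *)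

Lemma sqr_l2norm {R : realType} (n : nat) (v : 'cV[R]_n) :
  l2norm v ^+ 2 = \sum_(i < n) v i 0 ^+ 2.
Proof.
have vE : dotprod v v = \sum_(i < n) v i 0 ^+ 2.
  by apply: eq_bigr => i _; rewrite expr2.
by rewrite sqr_sqrtr vE// sumr_ge0// => i _; exact: sqr_ge0.
Qed.

Lemma coherence_ge0 {R : realType} (m n : nat) (A : 'M[R]_(m, n)) :
  0 <= coherence A.
Proof. exact: bigmax_ge_id. Qed.

Lemma expRB1_le {R : realType} (u : R) : u < 1 -> expR u - 1 <= u / (1 - u).
Proof.
move=> u1; rewrite ler_pdivlMr ?subr_gt0//.
have := expR_ge1Dx (- u); rewrite -(ler_pM2r (expR_gt0 u)) -expRD addNr expR0.
by nra.
Qed.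

Lemma le_of_forall_small {R : realType} (a rho : R) : 0 <= rho ->
  (forall v, 0 < v -> v < 1 -> a * (1 - 2 * v ^+ 2) <= rho * (1 - v ^+ 2)) ->
  a <= rho.
Proof.
move=> rho0 key.
rewrite leNgt; apply/negP => ra.
have a1 : 0 < a by apply: le_lt_trans ra.
(* The hypothesis gives [a - rho <= 2 * a * v ^+ 2 <= 2 * a * v], and this [v] makes the right side
   half of [a - rho]. *)
pose v := (a - rho) / (4 * a).
have v0 : 0 < v by rewrite divr_gt0 ?subr_gt0// mulr_gt0.
have vE : v * (4 * a) = a - rho by rewrite /v divfK// gt_eqF// mulr_gt0.
have v1 : v < 1 by nra.
have := key v v0 v1.
have : a * v ^+ 2 <= a * v by rewrite ler_pM2l// expr2 ler_piMr ?ltW.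
have : 0 <= rho * v ^+ 2 by rewrite mulr_ge0// sqr_ge0.
nra.
Qed.

(** * The risk bound over vectors supported on the first [s] coordinates *)

Section minimax.
Context {d : measure_display} {T : measurableType d} {R : realType}.
Variables (P : probability T R) (m n s : nat) (sigma : R).
Variables (A : 'M[R]_(m, n)) (z : 'I_m -> {RV P >-> R}).
Variable xhat : {mfun m.-tuple R >-> n.-tuple R}.
Hypotheses (sn : (s <= n)%N) (hA : forall j : 'I_n, l2norm (col j A) = 1).
Hypotheses (sigma_gt0 : 0 < sigma) (hz : isotropic_gaussian sigma z).

Let noise (w : T) : 'cV[R]_m := \col_(i < m) z i w.

(** Fixing the support makes [D] closed under the steps along its coordinates, as the box argument
    requires; the set of all [s]-sparse vectors is in general not closed. *)
Let D : set 'cV[R]_n := [set x | forall i : 'I_n, (s <= i)%N -> x i 0 = 0].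

Variable rho : R.
Hypothesis risk_le : forall x, D x ->
  (\int[P]_w (l2norm (cV_of_tuple (xhat (tuple_of_cV
     (observation A x (noise w)))) - x) ^+ 2)%:E <= rho%:E)%E.

Let err (x : 'cV[R]_n) (i : 'I_n) (w : T) : R :=
  tnth (xhat (tuple_of_cV (A *m x + noise w))) i - x i 0.

Let measurable_coord (i : 'I_n) (c : R) :
  measurable_fun setT (fun b : m.-tuple R => tnth (xhat b) i - c).
Proof.
apply: measurable_funB => //.
apply: (measurableT_comp (measurable_tnth i)); exact: measurable_funPT.
Qed.

Let measurable_err x i : measurable_fun setT (err x i).
Proof.
exact: (measurableT_comp (measurable_coord i (x i 0))
  (measurable_shifted_noise z (A *m x))).
Qed.

Let sum_sqr_err_le x : D x ->
  (\sum_(i < n) \int[P]_w (err x i w ^+ 2)%:E <= rho%:E)%E.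
Proof.
move=> Dx; rewrite -ge0_integral_sum//; first last.
- by move=> i w _; rewrite lee_fin sqr_ge0.
- by move=> i; apply/measurable_EFinP/measurable_funX/measurable_err.
apply: le_trans (risk_le Dx); rewrite le_eqVlt; apply/orP; left; apply/eqP.
apply: eq_integral => w _; rewrite sqr_l2norm sumEFin; congr (_%:E).
by apply: eq_bigr => i _; rewrite !mxE.
Qed.

Let integrable_sqr_err x i : D x ->
  P.-integrable setT (fun w => (err x i w ^+ 2)%:E).
Proof.
move=> Dx; apply/integrableP; split.
  exact/measurable_EFinP/measurable_funX/measurable_err.
under eq_integral do rewrite gee0_abs ?lee_fin ?sqr_ge0//.
apply: le_lt_trans (ltry rho); apply: le_trans (sum_sqr_err_le Dx).
rewrite (bigD1 i)//= leeDl// sume_ge0// => j _.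
by apply: integral_ge0 => w _; rewrite lee_fin sqr_ge0.
Qed.

Let sum_Rintegral_sqr_err_le x : D x ->
  \sum_(i < n) \int[P]_w (err x i w ^+ 2) <= rho.
Proof.
move=> Dx; rewrite -lee_fin -sumEFin; apply: le_trans (sum_sqr_err_le Dx).
rewrite le_eqVlt; apply/orP; left; apply/eqP; apply: eq_bigr => i _.
by rewrite fineK// integrable_fin_num//; exact: integrable_sqr_err.
Qed.

Let coords := [seq i : 'I_n <- enum 'I_n | (i < s)%N].

Let size_coords : size coords = s.
Proof.
rewrite size_filter -(count_map val (fun k => (k < s)%N)) val_enum_ord.
rewrite -size_filter; apply/eqP.
rewrite (_ : [seq k <- iota 0 n | (k < s)%N] = iota 0 s) ?size_iota//.
rewrite -(subnKC sn) iotaD filter_cat add0n.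
rewrite (eq_in_filter (a2 := predT)) ?filter_predT; last first.
  by move=> k; rewrite mem_iota.
rewrite (eq_in_filter (a2 := pred0)) ?filter_pred0 ?cats0//.
by move=> k; rewrite mem_iota => /andP[sk _]; rewrite ltnNge sk.
Qed.

Let step (h : R) (i : 'I_n) : 'cV[R]_n := h *: delta_mx i 0.

Let D_step h i x : i \in coords -> D x -> D (x + step h i).
Proof.
rewrite mem_filter => /andP[si _] Dx j sj; rewrite !mxE Dx// add0r.
case: eqP => [ji|_]; last by rewrite mulr0.
by move: si; rewrite -ji ltnNge sj.
Qed.

(** Chapman--Robbins for the [i]-th coordinate of [xhat] centred at [x i 0]. At the shifted point
    this centring is off by [h], whence the term [h]; the unit column gives the shift squared length
    [h ^+ 2]. *)
Let drift_le h lam i x : 0 < lam -> i \in coords -> D x ->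
  h + (\int[P]_w err (x + step h i) i w - \int[P]_w err x i w) <=
  lam / 2 * \int[P]_w (err x i w ^+ 2) +
    (expR (h ^+ 2 / sigma ^+ 2) - 1) / (2 * lam).
Proof.
move=> lam0 ic Dx.
have := gaussian_chapman_robbins sigma_gt0 hz (u := A *m x) (A *m step h i) lam0
  (measurable_coord i (x i 0)) (integrable_sqr_err i Dx).
have -> : dotprod (A *m step h i) (A *m step h i) = h ^+ 2.
  rewrite /step -scalemxAr -colE.
  have := hA i; rewrite /l2norm => /(congr1 (fun y => y ^+ 2)).
  rewrite sqr_sqrtr ?expr1n; last by apply: sumr_ge0 => j _; rewrite -expr2 sqr_ge0.
  move=> dE; rewrite -[RHS]mulr1 -dE /dotprod mulr_sumr.
  by apply: eq_bigr => j _; rewrite !mxE; ring.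
apply: le_trans; rewrite addrA lerD2r.
have i1 : P.-integrable setT (fun _ : T => h%:E).
  exact: finite_measure_integrable_cst.
have ie : P.-integrable setT (fun w => (err (x + step h i) i w)%:E).
  apply: sqr_integrable_integrable; first exact: measurable_err.
  exact/integrable_sqr_err/D_step.
rewrite -[X in X + _](Rintegral_probability_cst P h) -RintegralD//.
rewrite le_eqVlt; apply/orP; left; apply/eqP.
apply: eq_Rintegral => w _; rewrite /err mulmxDr !mxE !eqxx /=; ring.
Qed.

(** Summed over [coords], the drift bounds make the right side minus the left an upper bound on the
    divergence of the bias at every point of [D]. The bias is bounded by [1 + rho], so this constant
    is nonnegative. *)
Let minimax_step h lam : 0 < lam ->
  s%:R * h <= lam / 2 * rho +
    s%:R * ((expR (h ^+ 2 / sigma ^+ 2) - 1) / (2 * lam)).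
Proof.
move=> lam0; rewrite -subr_ge0.
pose G i x := \int[P]_w err x i w.
apply: (@discrete_divergence_ge0 R _ _ (step h) coords D G (1 + rho) _ 0).
- by move=> i y; exact: D_step.
- by move=> i _; rewrite mxE.
- move=> i y _ Dy; apply: le_trans (normr_Rintegral_le_sqr _ _) _.
  + exact: measurable_err.
  + exact: integrable_sqr_err.
  rewrite lerD2l; apply: le_trans (sum_Rintegral_sqr_err_le Dy).
  rewrite (bigD1 i)//= lerDl sumr_ge0// => j _.
  by apply: Rintegral_ge0 => w _; exact: sqr_ge0.
move=> y Dy; set c := _ / (2 * lam).
have sum_cst (b : R) : \sum_(i <- coords) b = s%:R * b.
  by rewrite big_const_seq count_predT iter_addr_0 size_coords mulr_natl.
have H : \sum_(i <- coords) (h + (G i (y + step h i) - G i y)) <=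
    \sum_(i <- coords) (lam / 2 * \int[P]_w (err y i w ^+ 2) + c).
  rewrite big_seq [leRHS]big_seq; apply: ler_sum => i ic.
  exact: drift_le.
move: H; rewrite !big_split /= !sum_cst -mulr_sumr => H.
have E : lam / 2 * \sum_(i <- coords) \int[P]_w (err y i w ^+ 2) <= lam / 2 * rho.
  rewrite ler_pM2l ?divr_gt0//; apply: le_trans (sum_Rintegral_sqr_err_le Dy).
  rewrite big_filter big_enum_cond /= [leRHS](bigID (fun i : 'I_n => (i < s)%N)) /=.
  rewrite lerDl sumr_ge0// => i _.
  by apply: Rintegral_ge0 => w _; exact: sqr_ge0.
lra.
Qed.

(* The optimal weight is [lam = h / sigma ^ 2]; then the step [h = sigma * v]
   is sent to 0. *)
Lemma sparse_minimax_risk_ge : s%:R * sigma ^+ 2 <= rho.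
Proof.
have rho0 : 0 <= rho.
  apply: le_trans (sum_Rintegral_sqr_err_le (x := 0) _); last first.
    by move=> i _; rewrite mxE.
  by apply: sumr_ge0 => i _; apply: Rintegral_ge0 => w _; exact: sqr_ge0.
set a := s%:R * sigma ^+ 2.
have a0 : 0 <= a by rewrite mulr_ge0// sqr_ge0.
have key v : 0 < v -> v < 1 -> a * (1 - 2 * v ^+ 2) <= rho * (1 - v ^+ 2).
  move=> v0 v1.
  have v21 : 0 < 1 - v ^+ 2 by nra.
  have lam0 : 0 < v / sigma by rewrite divr_gt0.
  have := minimax_step (sigma * v) lam0.
  have -> : (sigma * v) ^+ 2 / sigma ^+ 2 = v ^+ 2.
    by field; rewrite gt_eqF.
  have := expRB1_le (u := v ^+ 2); rewrite -subr_gt0 => /(_ v21).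
  set e := expR _ - 1; rewrite ler_pdivlMr// => he.
  (* The factor is [2 / lam], which gives [rho] the coefficient 1. *)
  rewrite -(ler_pM2r (x := 2 * sigma / v)) ?divr_gt0 ?mulr_gt0//.
  rewrite (_ : s%:R * (sigma * v) * _ = 2 * a); last first.
    by rewrite /a; field; rewrite gt_eqF.
  rewrite (_ : _ * (2 * sigma / v) = rho + a * e / v ^+ 2); last first.
    by rewrite /a; field; rewrite !gt_eqF.
  rewrite -(ler_pM2r v21) => H.
  (* By [he], the exponential term costs at most [a], which is absorbed by the [2 * a] on the
     left. *)
  have : a * e / v ^+ 2 * (1 - v ^+ 2) <= a.
    rewrite mulrAC ler_pdivrMr ?exprn_gt0// -mulrA ler_wpM2l//.
  nra.
exact: le_of_forall_small key.
Qed.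

End minimax.

(** * From the fixed support to the supremum over sparse vectors *)

Theorem theorem2p8 (R : realType) (m n s : nat) (hmn : (m < n)%N)
    (hs : (1 <= s <= n)%N)
    (A : 'M[R]_(m, n)) (hA : forall j : 'I_n, l2norm (col j A) = 1)
    (sigma : R) (hsigma : 0 < sigma)
    (d : measure_display) (T : measurableType d) (P : probability T R)
    (z : 'I_m -> {RV P >-> R}) (hz : isotropic_gaussian sigma z)
    (xhat : {mfun m.-tuple R >-> n.-tuple R}) :
  ((s%:R * sigma ^+ 2 / (1 + (s%:R - 1) * coherence A))%:E <=
   ereal_sup [set 'E_P[fun w : T =>
       (l2norm (cV_of_tuple (xhat (tuple_of_cV
          (observation A x (\col_(i < m) z i w)))) - x) ^+ 2)%R]
     | x in [set x : 'cV[R]_n | (l0norm x <= s)%N]])%E.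
Proof.
have /andP[s1 sn] := hs.
set S := (X in ereal_sup X).
have risk_le_sup (x : 'cV[R]_n) : (forall i : 'I_n, (s <= i)%N -> x i 0 = 0) ->
    (\int[P]_w (l2norm (cV_of_tuple (xhat (tuple_of_cV
      (observation A x (\col_(i < m) z i w)))) - x) ^+ 2)%:E <= ereal_sup S)%E.
  move=> Dx; apply: ereal_sup_ubound; exists x; last by rewrite unlock.
  (* The support of [x] lies in the image of ['I_s] under this injection, so it has at most [s]
     elements. *)
  have winj : injective (widen_ord sn).
    by move=> i j /(congr1 val) /= /val_inj.
  rewrite /= /l0norm -[leqRHS](card_ord s) -(card_codom winj).
  apply: subset_leq_card; apply/fintype.subsetP => i; rewrite inE => xi.
  have si : (i < s)%N by rewrite ltnNge; apply: contraNN xi => /Dx ->.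
  by apply/codomP; exists (Ordinal si); exact: val_inj.
have sup_ge0 : (0 <= ereal_sup S)%E.
  apply: le_trans (risk_le_sup 0 _); last by move=> i _; rewrite mxE.
  by apply: integral_ge0 => w _; rewrite lee_fin sqr_ge0.
apply: (@le_trans _ _ (s%:R * sigma ^+ 2)%:E).
  have s1R : 0 <= s%:R - 1 :> R by rewrite subr_ge0 ler1n.
  have den1 : 1 <= 1 + (s%:R - 1) * coherence A.
    by rewrite lerDl mulr_ge0// coherence_ge0.
  have den0 := lt_le_trans ltr01 den1.
  by rewrite lee_fin ler_pdivrMr// ler_peMr// mulr_ge0// sqr_ge0.
(* A real supremum is a valid [rho], an infinite one is trivial, and [-oo] is excluded by
   nonnegativity. *)
move: (ereal_sup S) sup_ge0 risk_le_sup => [rho _ risk_le|_ _|//].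
- by rewrite lee_fin; exact: (sparse_minimax_risk_ge sn hA hsigma hz risk_le).
- exact: leey.
Qed.
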